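(* If $X$ is a compact LOTS, then $X$ is dissipated.
   Context: All spaces are Hausdorff; $f:X\to Y$ always denotes a continuous map. A LOTS is a totally ordered set with the order topology. A subset of a space is perfect iff it is closed, non-empty and has no isolated points; a space is scattered iff it has no perfect subsets. Let $X,Y$ be compact and $f:X\to Y$. A loose family for $f$ is a disjoint family $\mathcal P$ of closed subsets of $X$ such that for some non-scattered $Q\subseteq Y$, $Q=f(P)$ for all $P\in\mathcal P$. The map $f$ is tight iff there is no loose family for $f$ of size $2$. For compact $X,Y,Z$, $f:X\to Y$ and $g:X\to Z$, $f$ is finer than $g$ iff there is a continuous $\Gamma:f(X)\to g(X)$ with $g=\Gamma\circ f$. $X$ is dissipated iff $X$ is compact and whenever $g:X\to Z$ with $Z$ compact metrizable, there is a tight $f:X\to Y$, for some compact metrizable $Y$, that is finer than $g$. *)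

(* Defs.v *)
From HB Require Import structures.
From mathcomp Require Import all_boot all_order all_algebra.
From mathcomp Require Import all_classical all_reals topology.

Set Implicit Arguments.
Unset Strict Implicit.
Unset Printing Implicit Defensive.

Import Order.TTheory GRing.Theory Num.Theory.

Local Open Scope classical_set_scope.
Local Open Scope ring_scope.

(* All spaces are Hausdorff, so "compact" means compact Hausdorff. *)
Definition compact_space (T : topologicalType) : Prop :=
  hausdorff_space T /\ compact [set: T].

(* The first four conditions are the fields of the factory [isMetric]. *)
Definition metrizable (R : realType) (T : topologicalType) : Prop :=
  exists dist : T -> T -> R,
    [/\ forall x, dist x x = 0,
        forall x y, dist x y = 0 -> x = y,
        forall x y, dist x y = dist y x,
        forall y x z, dist x z <= dist x y + dist y z &
        forall x, nbhs x = filter_from [set e : R | 0 < e]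
                                       (fun e => [set y | dist x y < e])].

(* Unlike the library's [perfect_set], a perfect set is non-empty here. *)
Definition perfect (T : topologicalType) (A : set T) : Prop :=
  [/\ closed A, A !=set0 & isolated A = set0].

Definition scattered (T : topologicalType) : Prop :=
  ~ exists A : set T, perfect A.

(* [set_type Q] carries the subspace topology. *)
Definition loose_family (X Y : topologicalType) (f : X -> Y)
    (P : set (set X)) : Prop :=
  [/\ trivIset P id,
      forall A, P A -> closed A &
      exists Q : set Y, ~ scattered (set_type Q) /\
        forall A, P A -> Q = f @` A].

Definition tight (X Y : topologicalType) (f : X -> Y) : Prop :=
  ~ exists P : set (set X), loose_family f P /\ (P #= `I_2)%card.

Definition to_range (X Y : Type) (f : X -> Y) (x : X) : set_type (range f) :=
  SigSub (mem_set (imageT f x)).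

Definition finer (X Y Z : topologicalType) (f : X -> Y) (g : X -> Z) : Prop :=
  exists Gamma : set_type (range f) -> set_type (range g),
    continuous Gamma /\ to_range g = Gamma \o to_range f.

Definition dissipated (R : realType) (X : topologicalType) : Prop :=
  compact_space X /\
  forall (Z : topologicalType) (g : X -> Z),
    compact_space Z -> metrizable R Z -> continuous g ->
    exists (Y : topologicalType) (f : X -> Y),
      [/\ compact_space Y, metrizable R Y, continuous f, tight f & finer f g].

(* Main.v *)
(* A continuous nondecreasing map [f : X -> R] is tight onto its range: a
   non-isolated point [q] of a common image of two closed sets is approached
   from one side, and then both closed sets contain the corresponding endpoint
   of the fibre over [q]. It remains to find such an [f] with [g] constant on
   its fibres. For [rho x y := min 1 (dist (g x) (g y))] and [e > 0], let [V]
   be the least nonnegative nondecreasing function on [X] with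
   [V x + rho x y <= V y + e] for [x <= y]; it is finite by compactness,
   continuous by minimality, and separates [x] and [y] whenever
   [e < rho x y]. A weighted sum of such functions over [e = 2^-n] is [f]. *)
Require Import Defs.
From HB Require Import structures.
From mathcomp Require Import all_boot all_order all_algebra.
From mathcomp Require Import all_classical all_reals topology normedtype.
From mathcomp Require Import lra.

Set Implicit Arguments.
Unset Strict Implicit.
Unset Printing Implicit Defensive.

Import Order.TTheory GRing.Theory Num.Theory.
Import numFieldNormedType.Exports.

Local Open Scope classical_set_scope.
Local Open Scope ring_scope.

(** * Limit points and tightness of nondecreasing maps *)

(** A perfect subset of [Q] has no isolated points, so each of its points is a limit of its other
    points. *)
Lemma nonscattered_limit_point (Y : topologicalType) (Q : set Y) :
  ~ scattered (set_type Q) -> exists2 q, Q q & closure (Q `\ q) q.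
Proof.
move=> /contrapT[A [_ [a Aa] iA]]; exists (set_val a); first exact: set_valP.
move=> U nU; have : limit_point A a.
  have := subset_closure Aa.
  by rewrite closure_isolated_limit_point iA set0U.
move=> /(_ _ (initial_continuous nU)) [b [ba Ab Ub]].
exists (set_val b); split => //; split; first exact: set_valP.
by move=> /= /val_inj bea; rewrite bea eqxx in ba.
Qed.

Lemma continuous_closed_image (X Y : topologicalType) (f : X -> Y) (A : set X) :
  compact [set: X] -> hausdorff_space Y -> continuous f -> closed A ->
  closed (f @` A).
Proof.
move=> cX hY cf cA; apply: compact_closed => //.
apply: continuous_compact; first exact: continuous_subspaceT.
exact: subclosed_compact cA cX _.
Qed.

(** By compactness the intersection of [P] and [B] has a closed image; it contains the part of the
    image of [P] lying in [C], hence also [q]. *)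
Lemma closure_image_preimage (X Y : topologicalType) (f : X -> Y)
    (P B : set X) (C : set Y) (q : Y) :
  compact [set: X] -> hausdorff_space Y -> continuous f ->
  closed P -> closed B -> f @^-1` C `<=` B -> closure (f @` P `&` C) q ->
  exists l, [/\ P l, B l & f l = q].
Proof.
move=> cX hY cf cP cB CB clq.
have : (f @` (P `&` B)) q.
  apply: (continuous_closed_image cX hY cf (closedI cP cB)).
  move: clq; apply: closure_subset => _ [[x Px <-] Cfx].
  by exists x => //; split => //; exact: CB.
by case=> l [Pl Bl] fl; exists l.
Qed.

(** The map [e] transports the order of [R] to [Y]; it will be [set_val] on the range. *)
Lemma nondecreasing_tight (R : realType) (disp : Order.disp_t)
    (X : orderTopologicalType disp) (Y : topologicalType)
    (f : X -> Y) (e : Y -> R) :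
  compact [set: X] -> hausdorff_space Y -> continuous f ->
  injective e -> {homo e \o f : x y / (x <= y)%O} -> tight f.
Proof.
move=> cX hY cf ie mf [P [[tP clP [Q [nsQ QP]]] /card_esym cP]].
have [A [B [PA PB AB]]] : exists A B, [/\ P A, P B & A <> B].
  have /card_set_bijP[h [hP hi _]] := cP.
  exists (h 0%N), (h 1%N); split; [exact: hP|exact: hP|].
  by move/hi; rewrite !inE => /(_ isT isT).
have {}tP x : A x -> B x -> False.
  by move=> Ax Bx; apply: AB; apply: tP => //; exists x.
have [q Qq] := nonscattered_limit_point nsQ.
have -> : Q `\ q = (Q `&` [set y | e y < e q]) `|` (Q `&` [set y | e q < e y]).
  rewrite -setIUr; apply/seteqP; split=> y [Qy yq]; split => //=.
    by apply/orP; rewrite -neq_lt; apply/eqP => /ie.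
  by move=> yq'; case: yq; rewrite /= yq' ltxx.
have mono x y : e (f x) < e (f y) -> (x <= y)%O.
  by rewrite leNgt; apply: contraTN => /ltW/mf; rewrite leNgt.
(* Both sides at once: for [r] equal to [<=] or [>=], [M] collects the lower or upper bounds of the
   fibre over [q]. [A] and [B] each contain a fibre point in [M], an endpoint of the fibre, and
   antisymmetry makes it unique. *)
have key C (r : rel X) : antisymmetric r ->
    (forall w, closed [set x | r x w]) ->
    (forall x w, C (f x) -> f w = q -> r x w) -> ~ closure (Q `&` C) q.
  move=> ra rc rC clq.
  pose M := \bigcap_(w in [set w | f w = q]) [set x | r x w].
  have ex D : P D -> exists l, [/\ D l, M l & f l = q].
    move=> PD; apply: (@closure_image_preimage _ _ f D M C q) => //.
    - exact: clP.
    - by apply: closed_bigI => w _; exact: rc.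
    - by move=> x Cx w /= fw; exact: rC.
    - by rewrite -(QP _ PD).
  have [a [Aa Ma fa]] := ex _ PA; have [b [Bb Mb fb]] := ex _ PB.
  have ab : a = b by apply: ra; rewrite (Ma _ fb) (Mb _ fa).
  by apply: (tP a) => //; rewrite ab.
rewrite closureU => -[]; [apply: (key _ <=%O)|apply: (key _ >=%O)].
- exact: le_anti.
- by move=> w; have := @lray_closed _ _ w; rewrite set_itvE.
- by move=> x w /= xq fw; apply: mono; rewrite fw.
- exact: ge_anti.
- by move=> w; have := @rray_closed _ _ w; rewrite set_itvE.
- by move=> x w /= xq fw; apply: mono; rewrite fw.
Qed.

(** * Maps onto the range and factorization through fibres *)

Lemma to_range_continuous (X Y : topologicalType) (f : X -> Y) :
  continuous f -> continuous (to_range f).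
Proof. by move=> cf; apply: continuous_comp_initial. Qed.

Lemma to_range_surj (X Y : Type) (f : X -> Y) (y : set_type (range f)) :
  exists x, to_range f x = y.
Proof.
by case: y => y /[dup] /set_mem[x _ <-] yf; exists x; exact: val_inj.
Qed.

(** [Gamma] is [g] after a choice of preimages under [f]. It is continuous because the preimage of a
    closed [C] is the trace of the [f]-image of a closed set, closed by compactness. *)
Lemma finer_of_ker (X Y Z : topologicalType) (f : X -> Y) (g : X -> Z) :
  compact [set: X] -> hausdorff_space Y -> continuous f -> continuous g ->
  (forall x y, f x = f y -> g x = g y) -> finer f g.
Proof.
move=> cX hY cf cg fg.
pose s y := sval (cid (@to_range_surj _ _ f y)).
have sK y : to_range f (s y) = y by rewrite /s; case: cid.
exists (to_range g \o s); split; last first.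
  apply/funext => x /=; apply: val_inj => /=; apply: fg.
  by have /(congr1 set_val) := sK (to_range f x).
apply/continuous_closedP => C cC.
have -> : (to_range g \o s) @^-1` C =
          set_val @^-1` (f @` (to_range g @^-1` C)).
  apply/seteqP; split=> y /=.
    by move=> Cy; exists (s y) => //; rewrite -[in RHS](sK y).
  move=> [x Cx fx]; suff -> : to_range g (s y) = to_range g x by [].
  apply: val_inj; apply: fg; rewrite fx -[in RHS](sK y).
  by [].
apply: preimage_closed => [? _|]; first exact: initial_continuous.
apply: continuous_closed_image => //.
by apply: preimage_closed => // ? _; exact: to_range_continuous.
Qed.

Lemma set_type_hausdorff (T : topologicalType) (A : set T) :
  hausdorff_space T -> hausdorff_space (set_type A).
Proof.
move=> hT x y clxy; apply/val_inj/hT => U V nU nV.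
have [z [Uz Vz]] := clxy _ _ (initial_continuous nU) (initial_continuous nV).
by exists (set_val z).
Qed.

Lemma set_type_metrizable (R : realType) (A : set R) : metrizable R (set_type A).
Proof.
exists (fun x y => `|set_val x - set_val y|); split.
- by move=> x; rewrite subrr normr0.
- by move=> x y /normr0_eq0/subr0_eq/val_inj.
- by move=> x y; rewrite distrC.
- by move=> y x z; apply: le_trans (ler_normD _ _); rewrite addrA subrK.
move=> x; apply/seteqP; split => U.
  move=> [_ [[V oV <-] Vx] VU]; have : nbhs (set_val x) V by apply: open_nbhs_nbhs.
  move=> /nbhs_ballP[e e0 eV]; exists e => // y xy; apply: VU; exact: eV.
move=> [e e0 eU]; apply: filterS eU _.
apply: (@initial_continuous _ _ set_val x (ball (set_val x) e)).
by apply: nbhsx_ballx.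
Qed.

(** * Order-convexity and finite subcovers *)

Lemma itv_convex (disp : Order.disp_t) (T : porderType disp) (i : interval T)
    (x y z : T) : x \in i -> z \in i -> (x <= y <= z)%O -> y \in i.
Proof.
case: i => l r; rewrite !itv_boundlr => /andP[lx _] /andP[_ zr] /andP[xy yz].
by rewrite (le_trans lx) ?bnd_simp//= (le_trans _ zr) ?bnd_simp.
Qed.

Lemma compact_finite_subcover (X : topologicalType) (U : X -> set X) :
  compact [set: X] -> (forall x, nbhs x (U x)) ->
  exists s : seq X, forall y, exists2 i, i \in s & U i y.
Proof.
move=> cX nU; apply: contrapT => noS.
(* Without a finite subcover, the complements of finite unions generate a proper filter; its cluster
   point [x] is excluded by [U x]. *)
pose F := filter_from [set: seq X]
  (fun s => [set y | forall i, i \in s -> ~ U i y]).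
have FF : ProperFilter F.
  apply: filter_from_proper; first apply: filter_from_filter.
  - by exists [::].
  - move=> s t _ _; exists (s ++ t) => // y sty.
    by split=> i ist; apply: sty; rewrite mem_cat ist ?orbT.
  - move=> s _; apply: contrapT => sN; apply: noS; exists s => y.
    apply: contrapT => yN; apply: sN; exists y => i si Uiy.
    by apply: yN; exists i.
have [x [_ clx]] := cX F FF filterT.
have Fx : F (~` U x).
  by exists [:: x] => // y; apply; rewrite inE.
by have [y [/= nUy Uy]] := clx _ _ Fx (nU x).
Qed.

(** * Continuous nondecreasing functions separating points at large [rho] *)

Section step_function.
Variables (R : realType) (disp : Order.disp_t) (X : orderTopologicalType disp).
Variable rho : X -> X -> R.
Hypothesis rhoC : forall x y, rho x y = rho y x.
Hypothesis rho_triangle : forall y x z, rho x z <= rho x y + rho y z.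
Hypothesis rho_le1 : forall x y, rho x y <= 1.
Hypothesis rho_near : forall x (e : R), 0 < e -> \forall y \near x, rho x y < e.

Lemma small_convex_open (x : X) (e : R) : 0 < e ->
  exists i : interval X, [/\ open [set` i], x \in i &
    forall y z, y \in i -> z \in i -> rho y z < e].
Proof.
move=> e0; have : nbhs x [set y | rho x y < e / 2].
  by apply: rho_near; rewrite divr_gt0.
rewrite itv_nbhsE => -[i [oi xi] iU]; exists i; split => //.
  exact: itv_open_ends_open.
move=> y z /iU/= yx /iU/= xz; apply: le_lt_trans (rho_triangle x y z) _.
by rewrite (rhoC y x); lra.
Qed.

(** The slack [e] lets [W] ignore small oscillations, so that a bounded [W] exists even if [rho] has
    unbounded variation along [X]. *)
Definition rho_growing (e : R) (W : X -> R) :=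
  [/\ forall x, 0 <= W x, forall x y, (x <= y)%O -> W x <= W y &
      forall x y, (x <= y)%O -> W x + rho x y <= W y + e].

(* [W x] counts the members of a finite cover by intervals of [rho]-diameter
   less than [e] that lie entirely below [x]. *)
Lemma rho_growing_exists (e : R) : compact [set: X] -> 0 < e ->
  exists2 W, rho_growing e W & exists N : R, forall x, W x <= N.
Proof.
move=> cX e0.
pose I x := sval (cid (small_convex_open x e0)).
have IP x := svalP (cid (small_convex_open x e0)).
have oI x : open [set` I x] by have [] := IP x.
have xI x : x \in I x by have [] := IP x.
have dI x y z : y \in I x -> z \in I x -> rho y z < e.
  by have [_ _] := IP x; exact.
have [D cD] := compact_finite_subcover cX
  (fun x => open_nbhs_nbhs (conj (oI x) (xI x))).
pose below x i : bool := `[< forall u, u \in I i -> (u < x)%O >].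
exists (fun x => \sum_(i <- D) (below x i)%:R); last first.
  exists (\sum_(i <- D) 1) => x; apply: ler_sum => i _.
  by rewrite lern1 leq_b1.
have bm x y i : (x <= y)%O -> (below x i)%:R <= (below y i)%:R :> R.
  move=> xy; rewrite ler_nat; case bx : (below x i) => //.
  suff -> : below y i by [].
  by apply/asboolP => u ui; apply: lt_le_trans xy; move/asboolP: bx; exact.
split=> [x|x y xy|x y xy].
- by apply: sumr_ge0.
- by apply: ler_sum => i _; exact: bm.
(* Take a cover interval around [x]. If it contains [y], the slack absorbs [rho x y]; otherwise, by
   convexity, it lies below [y] but not below [x], so the count rises by at least 1. *)
have [i /= iD xi] := cD x.
have [yi|yi] := boolP (y \in I i).
  apply: lerD; last exact/ltW/(dI i).
  by apply: ler_sum => j _; exact: bm.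
rewrite (big_rem i iD)/= [in leRHS](big_rem i iD)/=.
have -> : below x i = false.
  by apply/asboolPn => /(_ x xi); rewrite ltxx.
have -> : below y i = true.
  apply/asboolP => u ui; rewrite ltNge; apply: contra yi => yu.
  by apply: (itv_convex xi ui); rewrite xy yu.
have := rho_le1 x y.
have : \sum_(j <- rem i D) (below x j)%:R <=
       \sum_(j <- rem i D) (below y j)%:R :> R.
  by apply: ler_sum => j _; exact: bm.
by rewrite /= mulr0n mulr1n; lra.
Qed.

Definition least_growing (e : R) (x : X) : R :=
  inf [set W x | W in rho_growing e].

Lemma least_growing_le e W x : rho_growing e W -> least_growing e x <= W x.
Proof.
move=> gW; apply: ge_inf; last by exists W.
by exists 0 => _ [V [V0 _ _] <-].
Qed.

Lemma le_least_growing e x a : (exists W, rho_growing e W) ->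
  (forall W, rho_growing e W -> a <= W x) -> a <= least_growing e x.
Proof.
move=> [W gW] aW; apply: lb_le_inf; first by exists (W x), W.
by move=> _ [V gV <-]; exact: aW.
Qed.

(** Each condition bounds a value of [W] below by a constant or by another value plus a constant, so
    it survives pointwise infima. *)
Lemma least_growingP e : (exists W, rho_growing e W) ->
  rho_growing e (least_growing e).
Proof.
move=> eW; split=> [x|x y xy|x y xy].
- by apply: le_least_growing => // W [].
- apply: le_least_growing => // W gW; have [_ + _] := gW.
  by move=> /(_ _ _ xy); apply: le_trans; exact: least_growing_le.
- rewrite -lerBlDr; apply: le_least_growing => // W gW.
  rewrite lerBlDr; have [_ _ /(_ _ _ xy)] := gW.
  by apply: le_trans; rewrite lerD2r; exact: least_growing_le.
Qed.

(* Capping [V := least_growing e] at [V y + d] on ]y, z] keeps it growing, so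
   minimality forces [V z <= V y + d]. *)
Lemma least_growing_osc e d (i : interval X) : (exists W, rho_growing e W) ->
  0 <= d <= e -> (forall y z, y \in i -> z \in i -> rho y z <= d) ->
  forall y z, y \in i -> z \in i -> (y <= z)%O ->
  least_growing e z <= least_growing e y + d.
Proof.
move=> eW /andP[d0 de] id y z yi zi yz.
have gV := least_growingP eW; set V := least_growing e in gV *.
have [V0 Vm Vr] := gV.
pose W t := if (y < t <= z)%O then Num.min (V t) (V y + d) else V t.
have WV t : W t <= V t by rewrite /W; case: ifP => // _; rewrite ge_min lexx.
suff gW : rho_growing e W.
  apply: le_trans (least_growing_le z gW) _; rewrite /W lexx andbT.
  by case: ltgtP yz => // [_ _|-> _]; [rewrite ge_min lexx orbT|rewrite lerDl].
have mi t : (y < t <= z)%O -> t \in i.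
  by move=> /andP[yt tz]; apply: (itv_convex yi zi); rewrite ltW.
split=> [t|s t st|s t st].
- by rewrite /W; case: ifP => // _; rewrite le_min V0 addr_ge0.
- rewrite {2}/W; case: ifPn => [tyz|_]; last exact: le_trans (WV s) (Vm _ _ st).
  rewrite le_min (le_trans (WV s) (Vm _ _ st))/=.
  rewrite /W; case: ifPn => [_|]; first by rewrite ge_min lexx orbT.
  rewrite negb_and -leNgt -ltNge => /orP[sy|]; first by rewrite ler_wpDr ?Vm.
  by case/andP: tyz => _ tz /lt_geF; rewrite (le_trans st tz).
- rewrite {2}/W; case: ifPn => [tyz|_]; last first.
    by apply: le_trans (Vr _ _ st); rewrite lerD2r.
  rewrite addr_minl le_min; apply/andP; split.
    by apply: le_trans (Vr _ _ st); rewrite lerD2r.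
  (* If [s] is capped too, both points lie in [i] and [rho s t <= d <= e]. *)
  rewrite /W; case: ifPn => [syz|].
    rewrite lerD ?ge_min ?lexx ?orbT//.
    by apply: le_trans de; apply: id; apply: mi.
  rewrite negb_and -leNgt -ltNge => /orP[sy|]; last first.
    by case/andP: tyz => _ tz /lt_geF; rewrite (le_trans st tz).
  (* Here [s <= y < t]: growth of [V] from [s] to [y] costs [e], and [rho y t] costs the further [d]
     allowed by the cap. *)
  have := Vr _ _ sy; have := rho_triangle y s t; have := id _ _ yi (mi _ tyz).
  lra.
Qed.

Lemma least_growing_continuous e : (exists W, rho_growing e W) -> 0 < e ->
  continuous (least_growing e : X -> R).
Proof.
move=> eW e0 x; apply/cvg_ballP => d d0.
(* The oscillation bound applies only up to [e]; halving [d] makes the final inequality strict. *)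
have m0 : 0 < Num.min (d / 2) e by rewrite lt_min e0 divr_gt0.
have [i [oi xi di]] := small_convex_open x m0.
have : nbhs x [set` i] by apply: open_nbhs_nbhs.
apply: filterS => y /= yi.
have osc := @least_growing_osc e (Num.min (d / 2) e) i eW.
have {}osc : forall y z, y \in i -> z \in i -> (y <= z)%O ->
  least_growing e z <= least_growing e y + Num.min (d / 2) e.
  apply: osc => [|? ? ? ?]; last exact/ltW/di.
  by rewrite ltW//= ge_min lexx orbT.
have [_ mV _] := least_growingP eW.
have md : Num.min (d / 2) e <= d / 2 by rewrite ge_min lexx.
rewrite /ball /= ltr_norml.
have [xy|/ltW yx] := leP x y.
  have := osc _ _ xi yi xy; have := mV _ _ xy.
  by move=> *; apply/andP; split; lra.
have := osc _ _ yi xi yx; have := mV _ _ yx.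
by move=> *; apply/andP; split; lra.
Qed.

Lemma separating_monotone (e : R) : compact [set: X] -> 0 < e ->
  exists h : X -> R, [/\ continuous h, forall x, 0 <= h x <= 1,
    {homo h : x y / (x <= y)%O} &
    forall x y, (x <= y)%O -> e < rho x y -> h x < h y].
Proof.
move=> cX e0; have [W0 gW0 [N WN]] := rho_growing_exists cX e0.
have eW : exists W, rho_growing e W by exists W0.
have [V0 Vm Vr] := least_growingP eW.
have VN x := le_trans (least_growing_le x gW0) (WN x).
(* A positive upper bound, used to rescale into the unit interval. *)
have N0 : 0 < `|N| + 1 by rewrite ltr_wpDl.
have NN := ler_norm N.
exists (fun x => (`|N| + 1)^-1 * least_growing e x); split.
- move=> x; apply: cvgMl_tmp; exact: least_growing_continuous.
- move=> x; rewrite mulr_ge0 ?invr_ge0 ?(ltW N0)//= mulrC ler_pdivrMr// mul1r.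
  by have := VN x; lra.
- by move=> x y xy; rewrite ler_pM2l ?invr_gt0// Vm.
- move=> x y xy exy; rewrite ltr_pM2l ?invr_gt0//.
  by have := Vr _ _ xy; lra.
Qed.

End step_function.

(** * Geometrically weighted sums of nondecreasing functions *)

Lemma half_pow_lt (R : realType) (c : R) : 0 < c ->
  exists n : nat, forall m : nat, (n <= m)%N -> 2^-1 ^+ m < c.
Proof.
move=> c0; exists (Num.truncn c^-1).+1 => m nm.
rewrite exprVn -[ltRHS]invrK ltf_pV2 ?posrE ?invr_gt0 ?exprn_gt0//.
apply: (lt_le_trans (truncnS_gt c^-1)).
by rewrite -natrX ler_nat (leq_trans nm)// ltnW// ltn_expl.
Qed.

Section weighted_sum.
Variables (R : realType) (disp : Order.disp_t) (X : orderTopologicalType disp).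
Variable h : nat -> X -> R.
Hypothesis h_continuous : forall n, continuous (h n).
Hypothesis h01 : forall n x, 0 <= h n x <= 1.
Hypothesis h_homo : forall n, {homo h n : x y / (x <= y)%O}.

Let S N x : R := \sum_(n < N) 2^-1 ^+ n.+1 * h n x.

Let w_gt0 n : 0 < 2^-1 ^+ n :> R.
Proof. by rewrite exprn_gt0// invr_gt0. Qed.

(** The increment is bounded by a telescoping difference, so [S N x + 2^-1 ^+ N] is nonincreasing in
    [N] and bounds every tail. *)
Let S_step N x : S N x <= S N.+1 x <= S N x + (2^-1 ^+ N - 2^-1 ^+ N.+1).
Proof.
rewrite /S big_ord_recr/=; have /andP[h0 h1] := h01 N x.
have := w_gt0 N.+1; have -> : 2^-1 ^+ N = 2 * 2^-1 ^+ N.+1 :> R.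
  by rewrite exprS mulrA divff ?pnatr_eq0// mul1r.
by move: (2^-1 ^+ N.+1) => w w0; apply/andP; split; nra.
Qed.

Let S_le N k x : S N x <= S (k + N) x /\
  S (k + N) x + 2^-1 ^+ (k + N) <= S N x + 2^-1 ^+ N.
Proof.
elim: k => [|k [IH1 IH2]]; first by rewrite add0n.
by rewrite addSn; have /andP[] := S_step (k + N) x; split; lra.
Qed.

Let S_le_tail N M x : S M x <= S N x + 2^-1 ^+ N.
Proof.
have [NM|/ltnW MN] := leqP N M.
  have [_] := S_le N (M - N) x; rewrite subnK//.
  by have := w_gt0 M; lra.
have [] := S_le M (N - M) x; rewrite subnK//.
by have := w_gt0 N; lra.
Qed.

(** The sum of the series, as the supremum of its nondecreasing partial sums. *)
Let F x := sup (range (S^~ x)).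

Let S_le_F N x : S N x <= F x.
Proof.
apply: ub_le_sup; last by exists N.
by exists (S 0 x + 2^-1 ^+ 0) => _ [M _ <-]; exact: S_le_tail.
Qed.

Let F_le N x : F x <= S N x + 2^-1 ^+ N.
Proof.
apply: ge_sup; first by exists (S 0 x), 0%N.
by move=> _ [M _ <-]; exact: S_le_tail.
Qed.

Let S_homo N x y : (x <= y)%O -> S N x <= S N y.
Proof.
by move=> xy; apply: ler_sum => n _; rewrite ler_pM2l// h_homo.
Qed.

Lemma monotone_weighted_sum : exists f : X -> R, [/\ continuous f,
  {homo f : x y / (x <= y)%O} &
  forall n x y, (x <= y)%O -> h n x < h n y -> f x < f y].
Proof.
exists F; split.
- move=> x; apply/cvg_ballP => e e0.
  have [N /(_ _ (leqnn N)) wN] := half_pow_lt (divr_gt0 e0 (ltr0n R 2)).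
  have SN : S N y @[y --> x] --> S N x.
    apply: cvg_big => [|n _]; first exact: add_continuous.
    apply: cvgMl_tmp; exact: h_continuous.
  move/cvg_ballP : SN => /(_ _ (divr_gt0 e0 (ltr0n R 2))).
  apply: filterS => y; rewrite /ball /= !ltr_norml => /andP[? ?].
  have := S_le_F N x; have := S_le_F N y; have := F_le N x; have := F_le N y.
  by move=> *; apply/andP; split; lra.
- move=> x y xy; apply: ge_sup; first by exists (S 0 x), 0%N.
  by move=> _ [N _ <-]; exact: le_trans (S_homo N xy) (S_le_F N y).
- move=> n x y xy hxy; pose c := 2^-1 ^+ n.+1 * (h n y - h n x).
  have c0 : 0 < c by rewrite mulr_gt0// subr_gt0.
  have [N wN] := half_pow_lt c0.
  pose M := maxn N n.+1.
  have nM : (n < M)%N by rewrite leq_maxr.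
  have SM : S M x + c <= S M y.
    rewrite /S (bigD1 (Ordinal nM))//= [leRHS](bigD1 (Ordinal nM))//=.
    rewrite addrAC -mulrDr [h n x + _]addrC subrK lerD2l.
    by apply: ler_sum => i _; rewrite ler_pM2l// h_homo.
  have := wN M (leq_maxl _ _); have := F_le M x; have := S_le_F M y.
  lra.
Qed.

End weighted_sum.

(** * A monotone real map refining [g], and the theorem *)

Lemma monotone_factor (R : realType) (disp : Order.disp_t)
    (X : orderTopologicalType disp) (Z : topologicalType) (g : X -> Z) :
  compact [set: X] -> metrizable R Z -> continuous g ->
  exists f : X -> R, [/\ continuous f, {homo f : x y / (x <= y)%O} &
    forall x y, f x = f y -> g x = g y].
Proof.
move=> cX [dist [dxx d0 dC dD nZ]] cg.
have dist_ge0 a b : 0 <= dist a b.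
  by have := dD b a a; rewrite dxx (dC b a); lra.
(* Truncation at 1 matches the unit jumps of the counting function and keeps the triangle
   inequality. *)
pose rho x y : R := Num.min 1 (dist (g x) (g y)).
have rhoC x y : rho x y = rho y x by rewrite /rho dC.
have rhoD y x z : rho x z <= rho x y + rho y z.
  rewrite /rho; have := dD (g y) (g x) (g z).
  have := dist_ge0 (g x) (g y); have := dist_ge0 (g y) (g z).
  rewrite !minEle; case: (leP 1 (dist (g x) (g z)));
    case: (leP 1 (dist (g x) (g y))); by case: (leP 1 (dist (g y) (g z))); lra.
have rho1 x y : rho x y <= 1 by rewrite /rho ge_min lexx.
have rho_near x (e : R) : 0 < e -> \forall y \near x, rho x y < e.
  move=> e0; have : nbhs x (g @^-1` [set z | dist (g x) z < e]).
    apply: cg; change (nbhs (g x) [set z | dist (g x) z < e]).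
    by rewrite nZ; exists e.
  apply: filterS => y /= ge.
  by rewrite /rho gt_min ge orbT.
have w0 n : 0 < 2^-1 ^+ n :> R by rewrite exprn_gt0// invr_gt0.
have /choice[h hP] n :=
  separating_monotone rhoC rhoD rho1 rho_near cX (w0 n).
have [|||f [cf mf sf]] := @monotone_weighted_sum _ _ _ h.
- by move=> n; have [] := hP n.
- by move=> n x; have [_ + _ _] := hP n; exact.
- by move=> n; have [] := hP n.
exists f; split => // x y; wlog xy : x y / (x <= y)%O => [H fxy|fxy].
  by case/orP : (le_total x y) => [/H|/H/(_ (esym fxy))/esym]; exact.
apply: contrapT => gxy.
have rho0 : 0 < rho x y.
  by rewrite lt_min ltr01/= lt_neqAle dist_ge0 andbT eq_sym; apply/eqP => /d0.
have [n /(_ _ (leqnn n)) nrho] := half_pow_lt rho0.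
have [_ _ _ /(_ _ _ xy nrho) hxy] := hP n.
by have := sf _ _ _ xy hxy; rewrite fxy ltxx.
Qed.

Theorem lemma3p4 (R : realType) (disp : Order.disp_t)
    (X : orderTopologicalType disp) :
  compact [set: X] -> dissipated R X.
Proof.
move=> cX; split; first by split => //; exact: order_hausdorff.
move=> Z g _ mZ cg; have [f [cf mf fg]] := monotone_factor cX mZ cg.
have hY : hausdorff_space (set_type (range f)).
  by apply: set_type_hausdorff; exact: order_hausdorff.
(* The range, unlike [R], is compact. *)
exists (set_type (range f)), (to_range f).
have cf' := to_range_continuous cf.
split => //.
- split=> //; rewrite -(_ : range (to_range f) = setT).
    by apply: continuous_compact => //; exact: continuous_subspaceT.
  by apply/seteqP; split => // y _; have [x] := to_range_surj y; exists x.
- exact: set_type_metrizable.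
- exact: (@nondecreasing_tight _ _ _ _ _ set_val).
- apply: finer_of_ker => // x y /(congr1 set_val) fxy; exact: fg.
Qed.
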